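(* Let $d\ge n$ with $n\mid d$, let $f_1,\dots,f_n:\mathbb R^d\to\mathbb R$ be differentiable and $f=\frac1n\sum_{i=1}^nf_i$. Assume that $f$ is $L$-smooth with $L>0$ ($\|\nabla f(x)-\nabla f(y)\|\le L\|x-y\|$ for all $x,y$), that $f(x)\ge f^*$ for all $x$ for some $f^*\in\mathbb R$, and that the Functional $(L_A,L_B)$ Inequality holds for $f_1,\dots,f_n$. Run MARINA-P with $w_i^0=x^0$ for all $i\in[n]$, probability $p\in(0,1]$, Perm$K$ compressors as $\mathcal C_i^t$, and step size $\gamma=\big(L+L_A\sqrt{\omega_P(1/p-1)}\big)^{-1}$, where $\omega_P=n-1$. Then for every $\varepsilon>0$ MARINA-P finds an $\varepsilon$-stationary point after $$\mathcal O\left(\frac{\delta^0}{\varepsilon}\left(L+L_A\sqrt{\frac{\omega_P}{p}}\right)\right)$$ iterations, where $\delta^0=f(x^0)-f^*$.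
   Context: $\|\cdot\|$ is the Euclidean norm. Functional $(L_A,L_B)$ Inequality ($L_A,L_B\ge0$): for all $x,u_1,\dots,u_n\in\mathbb R^d$, $\|\frac1n\sum_{i=1}^n(\nabla f_i(x+u_i)-\nabla f_i(x))\|^2\le L_A^2(\frac1n\sum_{i=1}^n\|u_i\|^2)+L_B^2\|\frac1n\sum_{i=1}^nu_i\|^2$. Perm$K$ compressors ($d=qn$, $q\ge1$ an integer): draw one uniformly random permutation $\pi$ of $\{1,\dots,d\}$ and set $\mathcal C_i(x)=n\sum_{j=q(i-1)+1}^{qi}x_{\pi_j}e_{\pi_j}$ for $i=1,\dots,n$ (the same $\pi$ for all $i$; $e_j$ the standard basis). At each iteration $t$ a fresh independent permutation is used for $\mathcal C_1^t,\dots,\mathcal C_n^t$. MARINA-P: for $t=0,1,\dots$: $g^t=\frac1n\sum_{i=1}^n\nabla f_i(w_i^t)$; $x^{t+1}=x^t-\gamma g^t$; draw $c^t\sim\mathrm{Bernoulli}(p)$ (one coin for all workers); for all $i\in[n]$, $w_i^{t+1}=x^{t+1}$ if $c^t=1$ and $w_i^{t+1}=w_i^t+\mathcal C_i^t(x^{t+1}-x^t)$ if $c^t=0$. The coins are independent of each other and of the compressors. An $\varepsilon$-stationary point is a (possibly random) point $\bar x$ with $\mathbb E\|\nabla f(\bar x)\|^2\le\varepsilon$. ''Finds an $\varepsilon$-stationary point after $\mathcal O(N)$ iterations'' means: there are a universal constant $c>0$ and an integer $0\le T\le cN$ such that $\bar x$ drawn uniformly at random from $\{x^0,\dots,x^T\}$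 (independently of everything else) is an $\varepsilon$-stationary point. *)

(* Defs.v *)
From HB Require Import structures.
From mathcomp Require Import all_boot all_order all_algebra perm.
From mathcomp Require Import all_classical all_reals all_analysis.

Set Implicit Arguments.
Unset Strict Implicit.
Unset Printing Implicit Defensive.

Import Order.TTheory GRing.Theory Num.Theory.
Import numFieldNormedType.Exports.

Local Open Scope classical_set_scope.
Local Open Scope ring_scope.

(* The library norm on 'rV[R]_d is the sup norm, hence this definition.  Both
   norms induce the same topology and the same notion of differentiability. *)
Definition enorm (R : realType) (d : nat) (x : 'rV[R]_d) : R :=
  Num.sqrt (\sum_(j < d) x 0 j ^+ 2).

Definition gradient (R : realType) (d : nat) (f : 'rV[R]_d -> R)
    (x : 'rV[R]_d) : 'rV[R]_d :=
  \row_(j < d) 'D_(delta_mx 0 j) f x.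

Definition smooth (R : realType) (d : nat) (L : R) (f : 'rV[R]_d -> R) : Prop :=
  forall x y, enorm (gradient f x - gradient f y) <= L * enorm (x - y).

Section Finite_sum_problem.
Context (R : realType) (n d : nat).
Implicit Types (f : 'I_n -> 'rV[R]_d -> R) (x : 'rV[R]_d).

Definition favg f x : R := n%:R^-1 * \sum_(i < n) f i x.

Definition functional_ineq (LA LB : R) f : Prop :=
  forall x (u : 'I_n -> 'rV[R]_d),
    enorm (n%:R^-1 *: \sum_(i < n) (gradient (f i) (x + u i) - gradient (f i) x))
      ^+ 2
    <= LA ^+ 2 * (n%:R^-1 * \sum_(i < n) enorm (u i) ^+ 2)
       + LB ^+ 2 * enorm (n%:R^-1 *: \sum_(i < n) u i) ^+ 2.

(* Workers and coordinates are numbered from 0: worker i owns the positions j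
   with q * i <= j < q * (i + 1), where q = d / n. *)
Definition PermK (s : 'S_d) (i : 'I_n) x : 'rV[R]_d :=
  n%:R *: \sum_(j < d | (d %/ n * i <= j < d %/ n * i.+1)%N)
            x 0 (s j) *: delta_mx 0 (s j).

Definition omegaP : R := n%:R - 1.

(* The pair (x^t, (w_i^t)_i) along one realization of the coins c and of the
   compressors C. *)
Fixpoint marinaP f (gamma : R) x0 (w0 : 'I_n -> 'rV[R]_d)
    (c : nat -> bool) (C : nat -> 'I_n -> 'rV[R]_d -> 'rV[R]_d) (t : nat) :
    'rV[R]_d * ('I_n -> 'rV[R]_d) :=
  if t is t'.+1 then
    let: (x, w) := marinaP f gamma x0 w0 c C t' in
    let g := n%:R^-1 *: \sum_(i < n) gradient (f i) (w i) in
    let x' := x - gamma *: g in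
    (x', fun i => if c t' then x' else w i + C t' i (x' - x))
  else (x0, w0).

End Finite_sum_problem.

Arguments PermK {R n d} s i x.
Arguments omegaP R n : clear implicits.

Section Random_elements.
Context (R : realType) (dO : measure_display) (Omega : measurableType dO).
Variable P : probability Omega R.

(* Measurability with respect to the full powerset sigma-algebra on S; only
   used for finite S. *)
Definition discrete_rv (S : Type) (X : Omega -> S) : Prop :=
  forall B : set S, measurable (X @^-1` B).

Definition uniform_rv (S : finType) (X : Omega -> S) : Prop :=
  discrete_rv X /\ forall s, P (X @^-1` [set s]) = (#|S|%:R^-1)%:E.

Definition bernoulli_rv (p : R) (X : Omega -> bool) : Prop :=
  discrete_rv X /\ forall B, P (X @^-1` B) = bernoulli_prob p B.

Definition generated_events (S : Type) (X : Omega -> S) : set (set Omega) :=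
  [set X @^-1` B | B in [set: set S]].

Definition mutually_independent (I : eqType) (F : I -> set (set Omega)) : Prop :=
  forall (J : seq I) (A : I -> set Omega), uniq J ->
    (forall i, i \in J -> F i (A i)) ->
    P (\bigcap_(i in [set` J]) A i) = (\prod_(i <- J) P (A i))%E.

(* Joint law of the coins c^t, of the permutations pi^t and of the index tau of
   the returned iterate.  In the index type of the independent family,
   Some (inl t) stands for c^t, Some (inr t) for pi^t and None for tau. *)
Definition marinaP_randomness (p : R) (d T : nat) (c : nat -> Omega -> bool)
    (pi : nat -> Omega -> 'S_d) (tau : Omega -> 'I_T.+1) : Prop :=
  [/\ forall t, bernoulli_rv p (c t),
      forall t, uniform_rv (pi t),
      uniform_rv tau
    & mutually_independent (fun k : option (nat + nat) =>
        match k with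
        | Some (inl t) => generated_events (c t)
        | Some (inr t) => generated_events (pi t)
        | None => generated_events tau
        end)].

Definition stationary (d : nat) (f : 'rV[R]_d -> R) (eps : R)
    (xbar : Omega -> 'rV[R]_d) : Prop :=
  ('E_P[fun w => (enorm (gradient f (xbar w)) ^+ 2)%R] <= eps%:E)%E.

End Random_elements.

(* Main.v *)
(* Every PermK draw satisfies (1/n) sum_i C_i(x) = x, so the average of the w_i^t
   is always x^t.  The L_B term of the functional inequality therefore vanishes,
   and |g^t - grad f(x^t)|^2 <= L_A^2 V^t with V^t = (1/n) sum_i |w_i^t - x^t|^2.
   Averaging over one step gives
     E V^{t+1} = (1 - p) (V^t + (n - 1) gamma^2 |g^t|^2),
   and together with the descent lemma the potential
     f(x^t) - fstar + gamma L_A^2 / (2 p) V^t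
   decreases in mean by at least gamma/2 |grad f(x^t)|^2.  Summing over t <= T
   bounds the mean squared gradient by 2 delta^0 / (gamma (T + 1)).  The least
   T + 1 exceeding 2 delta^0 (L + L_A sqrt(omega_P / p)) / eps makes this at most
   eps, whence the universal constant 2 (T = 0 included). *)

Require Import Defs.
From mathcomp Require Import all_boot all_order all_algebra perm.
From mathcomp Require Import all_classical all_reals all_analysis.
From mathcomp Require Import measurable_realfun ring lra.

Import Order.TTheory GRing.Theory Num.Theory.
Import numFieldNormedType.Exports.

Local Open Scope classical_set_scope.
Local Open Scope ring_scope.

Lemma sum_finType_const {R : pzRingType} {I : finType} (x : R) :
  \sum_(i : I) x = #|{: I}|%:R * x.
Proof. by rewrite mulr_natl -sumr_const; apply: eq_bigl => i; rewrite inE. Qed.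

(** * Euclidean geometry and the descent lemma *)

Section Euclidean.
Context {R : realType} {d : nat}.
Implicit Types (x y z : 'rV[R]_d) (a : R).

Definition dotp x y : R := \sum_(j < d) x 0 j * y 0 j.

Lemma dotpC x y : dotp x y = dotp y x.
Proof. by apply: eq_bigr => j _; rewrite mulrC. Qed.

Lemma dotpDl x y z : dotp (x + y) z = dotp x z + dotp y z.
Proof. by rewrite -big_split; apply: eq_bigr => j _; rewrite mxE mulrDl. Qed.

Lemma dotpZl a x y : dotp (a *: x) y = a * dotp x y.
Proof. by rewrite mulr_sumr; apply: eq_bigr => j _; rewrite mxE mulrA. Qed.

Lemma dotpBl x y z : dotp (x - y) z = dotp x z - dotp y z.
Proof. by rewrite -scaleN1r dotpDl dotpZl mulN1r. Qed.

Lemma dotpDr x y z : dotp x (y + z) = dotp x y + dotp x z.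
Proof. by rewrite dotpC dotpDl !(dotpC _ x). Qed.

Lemma dotpZr a x y : dotp x (a *: y) = a * dotp x y.
Proof. by rewrite dotpC dotpZl dotpC. Qed.

Lemma dotpBr x y z : dotp x (y - z) = dotp x y - dotp x z.
Proof. by rewrite dotpC dotpBl !(dotpC _ x). Qed.

Lemma dotp_sumr (I : finType) x (y : I -> 'rV[R]_d) :
  dotp x (\sum_i y i) = \sum_i dotp x (y i).
Proof.
rewrite /dotp exchange_big; apply: eq_bigr => j _ /=.
by rewrite summxE mulr_sumr.
Qed.

Lemma enorm_sqr x : enorm x ^+ 2 = dotp x x.
Proof.
rewrite sqr_sqrtr; first by apply: eq_bigr => j _; rewrite expr2.
by apply: sumr_ge0 => j _; exact: sqr_ge0.
Qed.

Lemma enorm_ge0 x : 0 <= enorm x.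
Proof. exact: sqrtr_ge0. Qed.

Lemma enorm0 : enorm (0 : 'rV[R]_d) = 0.
Proof. by rewrite /enorm big1 ?sqrtr0// => j _; rewrite mxE expr0n. Qed.

Lemma enormZ_sqr a x : enorm (a *: x) ^+ 2 = a ^+ 2 * enorm x ^+ 2.
Proof. by rewrite !enorm_sqr dotpZl dotpZr; ring. Qed.

Lemma enormD_sqr x y :
  enorm (x + y) ^+ 2 = enorm x ^+ 2 + 2 * dotp x y + enorm y ^+ 2.
Proof. by rewrite !enorm_sqr dotpDl !dotpDr (dotpC y x); ring. Qed.

Lemma enormB_sqr x y :
  enorm (x - y) ^+ 2 = enorm x ^+ 2 - 2 * dotp x y + enorm y ^+ 2.
Proof. by rewrite !enorm_sqr dotpBl !dotpBr (dotpC y x); ring. Qed.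

(** Expanding [0 <= enorm (x - a *: y) ^+ 2] gives [2 * a * dotp x y <= enorm x ^+ 2 + a ^+ 2 *
    enorm y ^+ 2], at most [2 * a ^+ 2 * enorm y ^+ 2]. This stands in for the Cauchy-Schwarz
    inequality. *)
Lemma dotp_le_enorm a x y : 0 < a -> enorm x <= a * enorm y ->
  dotp x y <= a * enorm y ^+ 2.
Proof.
move=> a0 xy.
have : 0 <= enorm (x - a *: y) ^+ 2 by exact: sqr_ge0.
rewrite enormB_sqr enormZ_sqr dotpZr => h.
have : enorm x ^+ 2 <= a ^+ 2 * enorm y ^+ 2.
  by rewrite -exprMn ler_sqr ?nnegrE ?mulr_ge0 ?enorm_ge0// ltW.
by move=> h2; rewrite -(ler_pM2l a0); nra.
Qed.

(** Linearity of the differential on the standard basis links it to [gradient], which is made of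
    partial derivatives. *)
Lemma diff_gradient (f : 'rV[R]_d -> R) x y : differentiable f x ->
  'd f x y = dotp (gradient f x) y.
Proof.
move=> df; rewrite [y in LHS]row_sum_delta linear_sum.
by apply: eq_bigr => j _; rewrite linearZ /= mxE deriveE// mulrC.
Qed.

Lemma is_derive_line (f : 'rV[R]_d -> R) x h (t : R) :
  differentiable f (x + t *: h) ->
  is_derive t 1 (fun s : R => f (x + s *: h)) (dotp (gradient f (x + t *: h)) h).
Proof.
move=> df.
have dl : is_diff t (fun s : R => x + s *: h) (fun s : R => s *: h).
  have := is_diffD (is_diff_cst x t) (is_diff_scalel t h).
  by rewrite add0r.
have dfl : is_diff t (f \o (fun s : R => x + s *: h))
    ('d f (x + t *: h) \o (fun s : R => s *: h)).
  by apply: is_diff_comp; exact: differentiableP.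
apply: DeriveDef; first exact: diff_derivable.
by rewrite deriveE// diff_val /= scale1r diff_gradient.
Qed.

(* Along the segment, the left-hand side minus the right-hand side has derivative
   [dotp (gradient f (x + t *: h) - gradient f x) h - L * t * enorm h ^+ 2],
   which smoothness makes nonpositive. *)
Lemma smooth_descent (L : R) (f : 'rV[R]_d -> R) x h :
  0 < L -> smooth L f -> (forall y, differentiable f y) ->
  f (x + h) <= f x + dotp (gradient f x) h + L / 2 * enorm h ^+ 2.
Proof.
move=> L0 sf df.
pose phi : R -> R := (fun s : R => f (x + s *: h)) - (dotp (gradient f x) h \*: id)
  - (L / 2 * enorm h ^+ 2) \*: (id ^+ 2).
have dphi (t : R) : is_derive t 1 phi
    (dotp (gradient f (x + t *: h)) h - dotp (gradient f x) h
     - L * t * enorm h ^+ 2).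
  apply: is_derive_eq.
    apply: is_deriveB.
    by apply: is_deriveB; exact: is_derive_line.
  by rewrite /GRing.scale /=; field.
have cphi : {within `[0, 1], continuous phi}.
  by apply: derivable_within_continuous => t _; exact: ex_derive.
have [c] := MVT ltr01 (fun t _ => dphi t) cphi.
rewrite in_itv/= => /andP[c0 _].
have : dotp (gradient f (x + c *: h) - gradient f x) h <= L * c * enorm h ^+ 2.
  apply: dotp_le_enorm; first exact: mulr_gt0.
  apply: (le_trans (sf _ _)); rewrite addrC addKr.
  suff -> : enorm (c *: h) = c * enorm h by rewrite mulrA.
  apply/eqP; rewrite -(@eqrXn2 _ 2)// ?mulr_ge0 ?enorm_ge0 ?ltW//.
  by rewrite enormZ_sqr exprMn.
have phiE t : phi t = f (x + t *: h) - dotp (gradient f x) h * t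
    - L / 2 * enorm h ^+ 2 * t ^+ 2 by [].
by rewrite dotpBl !phiE scale1r scale0r addr0; lra.
Qed.
End Euclidean.

(** * Permutation compressors: exact averaging, second moment, unbiasedness *)

Section PermK.
Context {R : realType} {n d : nat}.
Hypotheses (n0 : (0 < n)%N) (nd : (n %| d)%N).
Implicit Types (x y : 'rV[R]_d) (s : 'S_d) (i : 'I_n).

Definition block i (j : 'I_d) : bool := (d %/ n * i <= j < d %/ n * i.+1)%N.

(** [PermK] only rescales or erases coordinates: [k] survives when its position under [s] falls in
    the block of worker [i]. *)
Lemma PermK_coord s i x k :
  PermK s i x 0 k = n%:R * ((block i ((s^-1)%g k))%:R * x 0 k).
Proof.
rewrite mxE summxE; congr (_ * _).
rewrite big_mkcond /= (bigD1 ((s^-1)%g k)) //= big1 ?addr0 => [|j jk].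
  rewrite -/(block i _); case: (block _ _); rewrite ?mul0r// mul1r.
  by rewrite !mxE permKV !eqxx mulr1.
case: ifP => // _; rewrite !mxE eqxx /=.
suff -> : (k == s j) = false by rewrite mulr0.
by apply/negP => /eqP ksj; move: jk; rewrite ksj permK eqxx.
Qed.

(** The blocks partition the positions: the only owner of [j] is worker [j %/ (d %/ n)]. *)
Lemma sum_block_worker j : \sum_i (block i j)%:R = 1 :> R.
Proof.
have q0 : (0 < d %/ n)%N.
  by rewrite divn_gt0// dvdn_leq// (leq_trans _ (ltn_ord j)).
have jn : (j %/ (d %/ n) < n)%N by rewrite ltn_divLR// mulnC divnK.
have blockE i : block i j = (i == Ordinal jn).
  rewrite /block -val_eqE /= eqn_leq leq_divRL// -(ltnS (_ %/ _)) ltn_divLR//.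
  by rewrite !(mulnC (d %/ n)%N).
rewrite (bigD1 (Ordinal jn))//= blockE eqxx big1 ?addr0// => i /negPf ij.
by rewrite blockE ij.
Qed.

Lemma sum_block_coord i : n%:R * \sum_j (block i j)%:R = d%:R :> R.
Proof.
rewrite -natr_sum -natrM; congr _%:R.
rewrite -[RHS](divnK nd) mulnC; congr (_ * _)%N.
under eq_bigr do rewrite /block.
rewrite -(big_mkord xpredT (fun j => (d %/ n * i <= j < d %/ n * i.+1)%N : nat)).
rewrite -big_mkcond /=.
have -> : (\sum_(0 <= j < d | d %/ n * i <= j < d %/ n * i.+1) 1 =
   \sum_(d %/ n * i <= j < d %/ n * i.+1) 1)%N.
  rewrite [RHS](big_nat_widenl _ 0)// [RHS](big_nat_widen _ _ d); last first.
    by rewrite -[leqRHS](divnK nd) leq_mul2l ltn_ord orbT.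
  by apply: eq_bigl => j.
by rewrite sum_nat_const_nat muln1 mulnS addnK.
Qed.

Lemma sum_PermK s x : n%:R^-1 *: \sum_(i < n) PermK s i x = x.
Proof.
apply/rowP => k; rewrite mxE summxE.
under eq_bigr do rewrite PermK_coord.
rewrite -mulr_sumr -mulr_suml sum_block_worker mul1r mulKf//.
by rewrite pnatr_eq0 -lt0n.
Qed.

(** Each coordinate is kept by exactly one worker, where its square gains the factor [n ^ 2];
    averaging over the workers leaves [n]. *)
Lemma sum_enorm_PermK s x :
  n%:R^-1 * \sum_(i < n) enorm (PermK s i x) ^+ 2 = n%:R * enorm x ^+ 2.
Proof.
have n_neq0 : n%:R != 0 :> R by rewrite pnatr_eq0 -lt0n.
under eq_bigr do rewrite enorm_sqr.
rewrite exchange_big enorm_sqr !mulr_sumr /=; apply: eq_bigr => k _.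
transitivity (n%:R^-1 * \sum_(i < n)
   (block i ((s^-1)%g k))%:R * (n%:R ^+ 2 * (x 0 k * x 0 k))).
  congr (_ * _); apply: eq_bigr => i _; rewrite PermK_coord.
  by case: (block _ _) => /=; ring.
by rewrite -mulr_suml sum_block_worker; field.
Qed.

(** Multiplying [s] by a transposition shows that the sum over permutations does not depend on [k].
    Summing over all [k] and exchanging the sums then leaves, for each [s], a reindexing of the sum
    of [F]. *)
Lemma sum_perm (F : 'I_d -> R) k :
  d%:R * \sum_(s : 'S_d) F ((s^-1)%g k) = #|{: 'S_d}|%:R * \sum_j F j.
Proof.
have indep k' : \sum_(s : 'S_d) F ((s^-1)%g k') = \sum_(s : 'S_d) F ((s^-1)%g k).
  rewrite (reindex_inj (mulIg (tperm k k'))) /=; apply: eq_bigr => s _.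
  by rewrite invgM permM tpermV tpermR.
transitivity (\sum_(k' < d) \sum_(s : 'S_d) F ((s^-1)%g k')).
  by rewrite [RHS](eq_bigr _ (fun k' _ => indep k')) sumr_const card_ord mulr_natl.
rewrite exchange_big /= mulr_natl -sumr_const; apply: eq_bigr => s _.
by rewrite [RHS](reindex_inj (@perm_inj _ (s^-1)%g)).
Qed.

(** Unbiasedness: under a uniform permutation a coordinate lands in a given block with probability
    [1 / n], which the scaling by [n] compensates. *)
Lemma mean_PermK i x : #|{: 'S_d}|%:R^-1 *: \sum_s PermK s i x = x.
Proof.
apply/rowP => k; rewrite mxE summxE.
have d_neq0 : d%:R != 0 :> R by rewrite pnatr_eq0 -lt0n (leq_trans _ (ltn_ord k)).
have S_neq0 : #|{: 'S_d}|%:R != 0 :> R.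
  by rewrite pnatr_eq0 -lt0n; apply/card_gt0P; exists 1%g.
under eq_bigr do rewrite PermK_coord.
rewrite -mulr_sumr -mulr_suml.
apply: (mulfI d_neq0).
have := sum_perm (fun j => (block i j)%:R) k; have := sum_block_coord i.
set a := \sum_j _; set b := \sum_s _ => <- h.
have -> : n%:R * a * (#|{: 'S_d}|%:R^-1 * (n%:R * (b * x 0 k))) =
 n%:R * #|{: 'S_d}|%:R^-1 * (n%:R * a * b) * x 0 k by ring.
by rewrite h; field.
Qed.
End PermK.

(** * Finitely valued random elements and integration over their level sets *)

Section Discrete.
Context {R : realType} {dO : measure_display} {Omega : measurableType dO}.
Variable P : probability Omega R.
Local Open Scope ereal_scope.

Lemma setI_preimage_partition {I : finType} (Y : Omega -> I) (D : set Omega) :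
  D = \big[setU/set0]_i (D `&` Y @^-1` [set i]).
Proof.
rewrite -bigcup_seq; apply/seteqP; split => [w Dw|w [i _ []]//].
by exists (Y w); rewrite //= mem_index_enum.
Qed.

(** Slicing along the finitely many values of [Y] turns any preimage into a finite union of
    measurable sets. *)
Lemma discrete_rv_pair {I J : Type} (Y : Omega -> I) (Z : Omega -> J) :
  finite_set [set: I] -> discrete_rv Y -> discrete_rv Z ->
  discrete_rv (fun w => (Y w, Z w)).
Proof.
move=> finI mY mZ U.
rewrite (_ : _ @^-1` U = \bigcup_i
  (Y @^-1` [set i] `&` Z @^-1` [set z | U (i, z)])).
  by apply: fin_bigcup_measurable => // i _; exact: measurableI.
by apply/seteqP; split => [w Uw|w [i _ [/= <-]]//]; exists (Y w).
Qed.

Lemma discrete_rv_comp {I J : Type} (Y : Omega -> I) (h : I -> J) :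
  discrete_rv Y -> discrete_rv (h \o Y).
Proof. by move=> mY U; rewrite comp_preimage; exact: mY. Qed.

Lemma discrete_rv_measurable {I : Type} {Y : Omega -> I} (G : I -> R) {D} :
  measurable D -> discrete_rv Y -> measurable_fun D (EFin \o (G \o Y)).
Proof.
move=> mD mY; apply/measurable_EFinP => _ U mU; apply: measurableI => //.
exact: (mY (G @^-1` U)).
Qed.

Lemma ge0_integral_partition {I : finType} (Y : Omega -> I) D f :
  measurable D -> discrete_rv Y -> measurable_fun D f ->
  (forall w, 0 <= f w) ->
  \int[P]_(w in D) f w = \sum_i \int[P]_(w in D `&` Y @^-1` [set i]) f w.
Proof.
move=> mD mY mf f0; rewrite {1}(setI_preimage_partition Y D).
rewrite ge0_integral_bigsetU//.
- by move=> i; apply: measurableI => //; exact: mY.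
- exact: index_enum_uniq.
- exact: trivIset_preimage1_in.
- by rewrite -(setI_preimage_partition Y D).
Qed.
End Discrete.

(** * Markov chains driven by independent coins and uniform noise *)

Section Chain.
Context {R : realType} {S : Type} {B : finType}.
Variables (step : bool -> B -> S -> S) (s0 : S).
Implicit Types (G H : S -> R) (p : R).

Fixpoint chain (c : nat -> bool) (b : nat -> B) (t : nat) : S :=
  if t is t'.+1 then step (c t') (b t') (chain c b t') else s0.

Definition step_mean p G (s : S) : R :=
  #|B|%:R^-1 * \sum_b (p * G (step true b s) + (1 - p) * G (step false b s)).

(** The mean of [G] at time [t], obtained algebraically by applying the transition operator
    [step_mean] to [G] [t] times and evaluating at [s0]; [integral_chain] identifies it with an
    integral. *)
Fixpoint chain_mean p (t : nat) G : R :=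
  if t is t'.+1 then chain_mean p t' (step_mean p G) else G s0.

Lemma step_meanP p (a : R) G H s :
  step_mean p (fun s => a * G s + H s) s = a * step_mean p G s + step_mean p H s.
Proof.
rewrite /step_mean mulrCA -mulrDr; congr (_ * _).
by rewrite mulr_sumr -big_split; apply: eq_bigr => b _ /=; ring.
Qed.

Lemma chain_meanP p (a : R) t G H :
  chain_mean p t (fun s => a * G s + H s)
  = a * chain_mean p t G + chain_mean p t H.
Proof.
elim: t G H => //= t IH G H; rewrite -IH; congr chain_mean.
by apply/funext => s; rewrite step_meanP.
Qed.

Lemma chain_mean_sum p t (I : Type) (r : seq I) (a : I -> R) (G : I -> S -> R) :
  chain_mean p t (fun s => \sum_(i <- r) a i * G i s)
  = \sum_(i <- r) a i * chain_mean p t (G i).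
Proof.
elim: r => [|i r IH]; last first.
  rewrite big_cons -IH -chain_meanP; congr chain_mean.
  by apply/funext => s; rewrite big_cons.
(* Zero is written in the shape of [chain_meanP], so that the mean of the zero function cancels
   against itself. *)
transitivity (chain_mean p t (fun=> -1 * 0 + 0)).
  by congr chain_mean; apply/funext => s; rewrite !big_nil mulr0 addr0.
by rewrite chain_meanP big_nil; ring.
Qed.

(** The invariant [Q] confines the chain to states where [G] is known to be nonnegative. *)
Lemma chain_mean_ge0 p t G (Q : S -> Prop) : 0 <= p <= 1 ->
  Q s0 -> (forall c b s, Q s -> Q (step c b s)) ->
  (forall s, Q s -> 0 <= G s) -> 0 <= chain_mean p t G.
Proof.
move=> /andP[p0 p1] Q0 Qstep; elim: t G => [|t IH] G G0 /=; first exact: G0.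
apply: IH => s Qs; rewrite mulr_ge0 ?invr_ge0 ?ler0n// sumr_ge0// => b _.
by rewrite addr_ge0// mulr_ge0 ?subr_ge0// G0//; exact: Qstep.
Qed.

Lemma chain_mean_lyapunov p (k : R) T (Phi G : S -> R) (Q : S -> Prop) : 0 <= p <= 1 ->
  Q s0 -> (forall c b s, Q s -> Q (step c b s)) ->
  (forall s, Q s -> 0 <= Phi s) ->
  (forall s, Q s -> step_mean p Phi s <= Phi s - k * G s) ->
  k * \sum_(t < T) chain_mean p t G <= Phi s0.
Proof.
move=> p01 Q0 Qstep Phi0 dec.
(* Keeping the final mean potential makes the bound telescope by induction on [T]. *)
suff : k * \sum_(t < T) chain_mean p t G + chain_mean p T Phi <= Phi s0.
  by apply: le_trans; rewrite lerDl; exact: (chain_mean_ge0 _ _ _ Q).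
elim: T => [|T]; first by rewrite big_ord0 mulr0 add0r.
apply: le_trans; rewrite big_ord_recr /= mulrDr -addrA lerD2l.
have : 0 <= chain_mean p T (fun s => -1 * step_mean p Phi s + (- k * G s + Phi s)).
  by apply: (chain_mean_ge0 _ _ _ Q) => // s Qs; have := dec s Qs; lra.
by rewrite !chain_meanP; lra.
Qed.

Context {dO : measure_display} {Omega : measurableType dO}.
Variables (P : probability Omega R) (p : R).
Hypothesis p01 : 0 <= p <= 1.
Variables (c : nat -> Omega -> bool) (b : nat -> Omega -> B) (T : nat).
Variable tau : Omega -> 'I_T.+1.

Let F (k : option (nat + nat)) := match k with
  | Some (inl t) => generated_events (c t)
  | Some (inr t) => generated_events (b t)
  | None => generated_events tau
  end.

Hypotheses (c_bern : forall t, bernoulli_rv P p (c t))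
  (b_unif : forall t, uniform_rv P (b t)) (tau_unif : uniform_rv P tau)
  (ind : mutually_independent P F).

Let X t w := chain (c^~ w) (b^~ w) t.

(** The state at time [t] depends on finitely many finitely valued variables, so every subset of
    [S], even an uncountable [S], has a measurable preimage. *)
Lemma chain_discrete_rv t : discrete_rv (X t).
Proof.
elim: t => [|t IH] U.
    by rewrite -[X 0]/(cst s0) preimage_cst; case: ifP.
have mcb := discrete_rv_pair _ _ (@finite_finset _ _) (c_bern t).1 (b_unif t).1.
have mcbX := discrete_rv_pair _ _ (@finite_finset _ _) mcb IH.
exact: (discrete_rv_comp _ (fun x => step x.1.1 x.1.2 x.2) mcbX).
Qed.

Let index_after t (k : option (nat + nat)) : bool := match k with
  | Some (inl s) | Some (inr s) => (t <= s)%N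
  | None => true
  end.

Let event_measurable k E : F k E -> measurable E.
Proof.
by case: k => [[t|t]|] [U _ <-];
  [exact: (c_bern t).1|exact: (b_unif t).1|exact: tau_unif.1].
Qed.

(* Conditioning on an event that only involves noise from time [t] on (or [tau])
   does not affect the law of the chain at time [t]. *)
Lemma integral_chain t (J : seq (option (nat + nat))) A G :
  (forall s, 0 <= G s) -> uniq J -> (forall k, k \in J -> F k (A k)) ->
  all (index_after t) J ->
  (\int[P]_(w in \bigcap_(k in [set` J]) A k) (G (X t w))%:E
   = P (\bigcap_(k in [set` J]) A k) * (chain_mean p t G)%:E)%E.
Proof.
elim: t J A G => [|t IH] J A G G0 uJ FA allJ; set D := \bigcap_(k in _) _.
  have mD : measurable D.
    by apply: fin_bigcap_measurable => // k kJ; exact: event_measurable (FA _ kJ).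
  by rewrite /X /= integral_cst// muleC.
have mD : measurable D.
  by apply: fin_bigcap_measurable => // k kJ; exact: event_measurable (FA _ kJ).
have mcb := discrete_rv_pair _ _ (@finite_finset _ _) (c_bern t).1 (b_unif t).1.
rewrite (ge0_integral_partition P (fun w => (c t w, b t w)) D)//; last 2 first.
- exact/discrete_rv_measurable/chain_discrete_rv.
- by move=> w; rewrite lee_fin.
pose weight (x : bool) := if x then p else 1 - p.
have weightE x : P (c t @^-1` [set x]) = (weight x)%:E.
  rewrite (c_bern t).2 bernoulli_probE// !diracE /weight.
  by case: x; rewrite ?in_set1 ?mem_set ?memNset//= ?mule0 ?mule1 ?adde0 ?add0e.
have after_t k : k \in J -> index_after t.+1 k by move/(allP allJ).
have tJ : Some (inl t) \notin J by apply/negP => /after_t /=; rewrite ltnn.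
have tJ' : Some (inr t) \notin J by apply/negP => /after_t /=; rewrite ltnn.
have stepE x : (\int[P]_(w in D `&` (fun w => (c t w, b t w)) @^-1` [set x])
     (G (X t.+1 w))%:E
   = P D * (#|B|%:R^-1 * weight x.1 * chain_mean p t (G \o step x.1 x.2))%:E)%E.
  case: x => x y /=.
  (* The values of the coin and noise at time [t] join the conditioning events. Their indices are
     new because [J] only involves times from [t.+1] on, or [tau]. *)
  pose A' k := if k == Some (inl t) then c t @^-1` [set x]
    else if k == Some (inr t) then b t @^-1` [set y] else A k.
  pose J' := [:: Some (inl t), Some (inr t) & J].
  have A'J k : k \in J -> A' k = A k.
    move=> kJ; rewrite /A'; case: eqP => [kt|_]; first by rewrite -kt kJ in tJ.
    by case: eqP => [kt|//]; rewrite -kt kJ in tJ'.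
  have uJ' : uniq J' by rewrite /= in_cons negb_or tJ tJ' uJ.
  have FA' k : k \in J' -> F k (A' k).
    rewrite !in_cons => /or3P[/eqP ->|/eqP ->|kJ].
    - by rewrite /A' eqxx; exists [set x].
    - by rewrite /A' eqxx; exists [set y].
    - by rewrite A'J//; exact: FA.
  have allJ' : all (index_after t) J'.
    rewrite /= leqnn /=; apply/allP => k /after_t.
    by case: k => [[s|s]|] //=; exact: ltnW.
  have -> : D `&` (fun w => (c t w, b t w)) @^-1` [set (x, y)]
      = \bigcap_(k in [set` J']) A' k.
    apply/seteqP; split => [w [Dw [cw bw]] k|w Aw].
      rewrite /= !in_cons => /or3P[/eqP ->|/eqP ->|kJ].
      - by rewrite /A' eqxx.
      - by rewrite /A' eqxx.
      - by rewrite A'J//; exact: Dw.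
    split.
      by move=> k kJ; rewrite -A'J//; apply: Aw; rewrite /= !in_cons kJ !orbT.
    have := Aw (Some (inl t)); rewrite /= in_cons eqxx => /(_ isT).
    have := Aw (Some (inr t)); rewrite /= !in_cons eqxx orbT => /(_ isT).
    by rewrite /A' /= !eqxx => -> ->.
  (* On this event the last transition is the fixed map [step x y], so the induction hypothesis
     applies to [G \o step x y] at time [t]. *)
  transitivity (\int[P]_(w in \bigcap_(k in [set` J']) A' k)
      ((G \o step x y) (X t w))%:E)%E.
    apply: eq_integral => w; rewrite inE => Aw; congr (_%:E).
    have := Aw (Some (inl t)); rewrite /= in_cons eqxx => /(_ isT).
    have := Aw (Some (inr t)); rewrite /= !in_cons eqxx orbT => /(_ isT).
    by rewrite /A' /= !eqxx /X /= => -> ->.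
  rewrite IH//= ind// !big_cons /A' /= !eqxx weightE (b_unif t).2.
  rewrite (eq_big_seq (fun k => P (A k))) => [|k kJ]; last by congr (P _); exact: A'J.
  rewrite -(ind J A uJ FA) -/D -(fineK (fin_num_measure P D mD)) -!EFinM.
  by congr (_%:E); ring.
under eq_bigr do rewrite stepE.
rewrite -(fineK (fin_num_measure P D mD)).
under eq_bigr do rewrite -EFinM.
rewrite sumEFin -EFinM -mulr_sumr; congr (_ * _)%:E.
(* The weights of the pairs [(x, y)] are the transition probabilities, so their weighted sum is
   [step_mean]. *)
rewrite -chain_mean_sum /=; congr chain_mean; apply/funext => s.
rewrite /step_mean mulr_sumr -(pair_bigA _ (fun x y =>
  #|B|%:R^-1 * weight x * (G \o step x y) s)) /= exchange_big /=.
by apply: eq_bigr => y _; rewrite big_bool /=; ring.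
Qed.

(** Split along the value of [tau]; on each piece, [integral_chain] with [tau] as the only
    conditioning variable gives the factor [1 / (T + 1)]. *)
Lemma expectation_chain (G : S -> R) : (forall s, 0 <= G s) ->
  ('E_P[fun w => G (X (tau w) w)]
   = (T.+1%:R^-1 * \sum_(t < T.+1) chain_mean p t G)%:E)%E.
Proof.
move=> G0; have mtau := tau_unif.1.
have mX : discrete_rv (fun w => X (tau w) w).
  move=> U; rewrite (_ : _ @^-1` U = \bigcup_t (tau @^-1` [set t] `&` X t @^-1` U)).
    apply: fin_bigcup_measurable => // t _; apply: measurableI => //.
    exact: chain_discrete_rv.
  by apply/seteqP; split => [w Uw|w [t _ [/= <-]]//]; exists (tau w).
rewrite unlock (ge0_integral_partition P tau)//; last 2 first.
- exact: (discrete_rv_measurable G).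
- by move=> w; rewrite lee_fin.
rewrite mulr_sumr -sumEFin; apply: eq_bigr => t _.
have bigcap1 : \bigcap_(k in [set` [:: None : option (nat + nat)]]) tau @^-1` [set t]
    = tau @^-1` [set t].
  apply/seteqP; split => [w|w tw k _ //].
  by apply; rewrite /= inE.
have := integral_chain t [:: None] (fun=> tau @^-1` [set t]) G G0.
rewrite bigcap1 setTI tau_unif.2 card_ord -EFinM => <- //.
  by apply: eq_integral => w; rewrite inE /= => ->.
by move=> k; rewrite inE => /eqP ->; exists [set t].
Qed.
End Chain.

(** * MARINA-P as a chain and the decrease of its potential *)

Section MarinaP.
Context {R : realType} {n d : nat}.
Variables (f : 'I_n -> 'rV[R]_d -> R) (L LA LB p : R).
Hypotheses (n0 : (0 < n)%N) (nd : (n %| d)%N).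
Hypothesis df : forall i x, differentiable (f i) x.
Hypotheses (L0 : 0 < L) (sf : smooth L (favg f)).
Hypothesis (fi : functional_ineq LA LB f).
Hypotheses (p0 : 0 < p) (p1 : p <= 1).
Let state : Type := 'rV[R]_d * ('I_n -> 'rV[R]_d).
Implicit Types (x : 'rV[R]_d) (st : state) (s : 'S_d) (gamma : R).

Let n_neq0 : n%:R != 0 :> R. Proof. by rewrite pnatr_eq0 -lt0n. Qed.

Lemma favgE : favg f = n%:R^-1 *: (\sum_(i < n) f i).
Proof. by apply/funext => x; rewrite /favg !fctE fct_sumE. Qed.

Lemma differentiable_favg x : differentiable (favg f) x.
Proof. by rewrite favgE; apply: differentiableZ; exact: differentiable_sum. Qed.

Lemma gradient_favg x :
  gradient (favg f) x = n%:R^-1 *: \sum_(i < n) gradient (f i) x.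
Proof.
apply/rowP => j; rewrite !mxE summxE favgE deriveZ; last first.
  by apply: diff_derivable; exact: differentiable_sum.
rewrite derive_sum => [|i]; last exact: diff_derivable.
by congr (_ * _); apply: eq_bigr => i _; rewrite mxE.
Qed.

Definition estimator st : 'rV[R]_d :=
  n%:R^-1 *: \sum_(i < n) gradient (f i) (st.2 i).

Definition marinaP_step gamma (c : bool) s st : state :=
  let x' := st.1 - gamma *: estimator st in
  (x', fun i => if c then x' else st.2 i + PermK s i (x' - st.1)).

(** Makes the results on chains available, with the permutations as noise. *)
Lemma marinaP_chain gamma x0 w0 (c : nat -> bool) (pi : nat -> 'S_d) t :
  marinaP f gamma x0 w0 c (fun u i => PermK (pi u) i) t
  = chain (marinaP_step gamma) (x0, w0) c pi t.
Proof. by elim: t => //= t <-; case: marinaP. Qed.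

Definition centred st := n%:R^-1 *: \sum_(i < n) st.2 i = st.1.

Lemma centred_diag x : centred (x, fun=> x).
Proof.
by rewrite /centred /= sumr_const card_ord -(scaler_nat _ x) scalerA mulVf// scale1r.
Qed.

Lemma centred_step gamma c s st : centred st -> centred (marinaP_step gamma c s st).
Proof.
rewrite {1}/centred => cst; case: c; first exact: centred_diag.
rewrite /centred /= big_split /= scalerDr cst sum_PermK//.
by rewrite addrC subrK.
Qed.

Definition dispersion st : R :=
  n%:R^-1 * \sum_(i < n) enorm (st.2 i - st.1) ^+ 2.

Lemma dispersion_ge0 st : 0 <= dispersion st.
Proof. by rewrite mulr_ge0 ?invr_ge0 ?ler0n// sumr_ge0// => i _; exact: sqr_ge0. Qed.

Lemma dispersion_diag x : dispersion (x, fun=> x) = 0.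
Proof.
rewrite /dispersion big1 ?mulr0// => i _ /=.
by rewrite subrr enorm0 expr0n.
Qed.

(* Unbiasedness of the compressors only kills the cross term: with D = x' - x,
   the average over the workers of |C_i D - D|^2 is (n - 1) |D|^2 for every
   permutation. *)
Lemma mean_dispersion gamma st :
  #|{: 'S_d}|%:R^-1 * \sum_s dispersion (marinaP_step gamma false s st)
  = dispersion st + (n%:R - 1) * (gamma ^+ 2 * enorm (estimator st) ^+ 2).
Proof.
have S_neq0 : #|{: 'S_d}|%:R != 0 :> R.
  by rewrite pnatr_eq0 -lt0n; apply/card_gt0P; exists 1%g.
set g := estimator st; pose D := - (gamma *: g).
have D_sqr : enorm D ^+ 2 = gamma ^+ 2 * enorm g ^+ 2.
  by rewrite /D -scaleNr enormZ_sqr sqrrN.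
rewrite -D_sqr.
have stepE s i : enorm ((marinaP_step gamma false s st).2 i
      - (marinaP_step gamma false s st).1) ^+ 2
    = enorm (st.2 i - st.1) ^+ 2
      + 2 * (dotp (st.2 i - st.1) (PermK s i D) - dotp (st.2 i - st.1) D)
      + (enorm (PermK s i D) ^+ 2 - 2 * dotp D (PermK s i D) + enorm D ^+ 2).
  rewrite /marinaP_step /= -/g -/D [st.1 + D - _]addrC addKr.
  have -> : st.2 i + PermK s i D - (st.1 + D) = (st.2 i - st.1) + (PermK s i D - D).
    by rewrite opprD addrACA.
  by rewrite enormD_sqr (enormB_sqr (PermK s i D)) dotpBr (dotpC D).
have dispE s : dispersion (marinaP_step gamma false s st) =
    dispersion st + n%:R^-1 * (2 * \sum_i
      (dotp (st.2 i - st.1) (PermK s i D) - dotp (st.2 i - st.1) D))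
    + (n%:R - 1) * enorm D ^+ 2.
  set bias := (X in 2 * X).
  rewrite /dispersion (eq_bigr _ (fun i _ => stepE s i)) !big_split /= -mulr_sumr.
  rewrite -/bias sumrN -mulr_sumr -dotp_sumr sumr_const card_ord !mulrDr.
  rewrite sum_enorm_PermK// -(mulr_natl (enorm D ^+ 2)).
  have -> : \sum_(i < n) PermK s i D = n%:R *: D.
    by rewrite -{2}(sum_PermK n0 nd s D) scalerA divff// scale1r.
  by rewrite dotpZr -enorm_sqr; field.
rewrite (eq_bigr _ (fun s _ => dispE s)) !big_split /= !sum_finType_const.
rewrite -!mulr_sumr exchange_big /= big1 => [|i _]; last first.
  rewrite sumrB sum_finType_const -dotp_sumr -{2}(mean_PermK nd i D).
  by rewrite dotpZr mulVKf// subrr.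
by field; rewrite n_neq0.
Qed.

Lemma estimator_error st : centred st ->
  enorm (estimator st - gradient (favg f) st.1) ^+ 2 <= LA ^+ 2 * dispersion st.
Proof.
(* These displacements turn [x + u i] into the worker's point and have zero mean by [centred]. *)
move=> cst; have := fi st.1 (fun i => st.2 i - st.1).
under eq_bigr do rewrite (addrC st.1) subrK.
rewrite sumrB scalerBr -gradient_favg -/(estimator st) => /le_trans; apply.
rewrite (_ : n%:R^-1 *: \sum_(i < n) (st.2 i - st.1) = 0).
  by rewrite enorm0 expr0n mulr0 addr0.
have st1 : n%:R^-1 *: \sum_(i < n) st.1 = st.1 := centred_diag st.1.
by rewrite sumrB scalerBr cst st1 subrr.
Qed.

(** The coefficient [a] of [dispersion] solves [(1 - p) * a + gamma * LA ^+ 2 / 2 = a]: what a step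
    contracts pays exactly for the estimator error. *)
Definition lyapunov fstar gamma st : R :=
  favg f st.1 - fstar + gamma * LA ^+ 2 / (2 * p) * dispersion st.

(** Polarization turns the inner product in the descent lemma into the estimator error minus the
    squared norms of the estimator and of the gradient, each times [gamma / 2]. The step size
    condition lets the negative estimator term absorb the quadratic and compression terms. *)
Lemma lyapunov_decrease fstar gamma st : 0 < gamma ->
  gamma * L + gamma ^+ 2 * LA ^+ 2 * omegaP R n * (p^-1 - 1) <= 1 ->
  centred st ->
  step_mean (marinaP_step gamma) p (lyapunov fstar gamma) st
  <= lyapunov fstar gamma st - gamma / 2 * enorm (gradient (favg f) st.1) ^+ 2.
Proof.
move=> gamma0 small cst.
have S_neq0 : #|{: 'S_d}|%:R != 0 :> R.
  by rewrite pnatr_eq0 -lt0n; apply/card_gt0P; exists 1%g.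
set x' := st.1 - gamma *: estimator st; set a := gamma * LA ^+ 2 / (2 * p).
have -> : step_mean (marinaP_step gamma) p (lyapunov fstar gamma) st
   = favg f x' - fstar + (1 - p) * a * (dispersion st
      + (n%:R - 1) * (gamma ^+ 2 * enorm (estimator st) ^+ 2)).
  rewrite -mean_dispersion /step_mean (eq_bigr (fun s => (favg f x' - fstar)
     + (1 - p) * a * dispersion (marinaP_step gamma false s st))).
    by rewrite big_split /= sum_finType_const -mulr_sumr; field.
  (* A successful coin sends every worker to [x'], so only the branch of weight [1 - p] keeps a
     dispersion. *)
  by move=> s _; rewrite /lyapunov /= dispersion_diag -/x' -/a; ring.
have := smooth_descent L _ st.1 (- gamma *: estimator st) L0 sf differentiable_favg.
have := estimator_error st cst.
rewrite scaleNr -/x' -scaleNr dotpZr enormZ_sqr enormB_sqr dotpC /lyapunov -/a.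
set N := enorm (estimator st) ^+ 2; set G := enorm (gradient _ _) ^+ 2.
set V := dispersion st; set c := dotp _ _; rewrite -/(omegaP R n) => err desc.
have N0 : 0 <= N by exact: sqr_ge0.
have aE : gamma / 2 * LA ^+ 2 = p * a by rewrite /a; field; rewrite gt_eqF.
have step_small : (1 - p) * a * omegaP R n * gamma ^+ 2 * N
    + L / 2 * gamma ^+ 2 * N <= gamma / 2 * N.
  have -> : (1 - p) * a * omegaP R n * gamma ^+ 2 * N + L / 2 * gamma ^+ 2 * N
     = gamma / 2 * N *
       (gamma * L + gamma ^+ 2 * LA ^+ 2 * omegaP R n * (p^-1 - 1)).
    by rewrite /a; field; rewrite gt_eqF.
  by rewrite ler_piMr// mulr_ge0// divr_ge0// ltW.
have := ler_wpM2l (ltW (divr_gt0 gamma0 (ltr0Sn R 1))) err.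
rewrite mulrA aE.
lra.
Qed.

Lemma marinaP_rate fstar gamma x0 T : 0 < gamma ->
  gamma * L + gamma ^+ 2 * LA ^+ 2 * omegaP R n * (p^-1 - 1) <= 1 ->
  (forall x, fstar <= favg f x) ->
  \sum_(t < T) chain_mean (marinaP_step gamma) (x0, fun=> x0) p t
    (fun st => enorm (gradient (favg f) st.1) ^+ 2)
  <= 2 / gamma * (favg f x0 - fstar).
Proof.
move=> gamma0 small fge.
have p01 : 0 <= p <= 1 by rewrite ltW.
rewrite -ler_pdivrMl ?divr_gt0// invf_div.
(* All workers start at [x0], so the initial dispersion is zero. *)
have -> : favg f x0 - fstar = lyapunov fstar gamma (x0, fun=> x0).
  by rewrite /lyapunov dispersion_diag mulr0 addr0.
apply: (chain_mean_lyapunov _ _ _ _ _ _ _ centred) => //.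
- exact: centred_diag.
- exact: centred_step.
- move=> st _; rewrite /lyapunov addr_ge0 ?subr_ge0//.
  apply: mulr_ge0 (dispersion_ge0 _).
  by rewrite divr_ge0// pmulr_rge0 ?sqr_ge0// ltW.
- by move=> st; exact: lyapunov_decrease.
Qed.
End MarinaP.

(** * Step size, iteration count and conclusion *)

Theorem theorem4p6 (R : realType) :
  exists c : R, 0 < c /\
  forall (n d : nat) (f : 'I_n -> 'rV[R]_d -> R) (L LA LB fstar p eps : R)
    (x0 : 'rV[R]_d),
  (0 < n)%N -> (n <= d)%N -> (n %| d)%N ->
  (forall i x, differentiable (f i) x) ->
  0 < L -> smooth L (favg f) ->
  (forall x, fstar <= favg f x) ->
  0 <= LA -> 0 <= LB -> functional_ineq LA LB f ->
  0 < p -> p <= 1 -> 0 < eps ->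
  let gamma := (L + LA * Num.sqrt (omegaP R n * (p^-1 - 1)))^-1 in
  let delta0 := favg f x0 - fstar in
  exists T : nat,
    T%:R <= c * (delta0 / eps * (L + LA * Num.sqrt (omegaP R n / p))) /\
    forall (dO : measure_display) (Omega : measurableType dO)
      (P : probability Omega R)
      (coin : nat -> Omega -> bool) (pi : nat -> Omega -> 'S_d)
      (tau : Omega -> 'I_T.+1),
    marinaP_randomness P p coin pi tau ->
    let x (t : nat) (w : Omega) : 'rV[R]_d :=
      (marinaP f gamma x0 (fun=> x0) (coin^~ w)
               (fun s i => PermK (pi s w) i) t).1 in
    stationary P (favg f) eps (fun w => x (tau w) w).
Proof.
exists 2; split => // n d f L LA LB fstar p eps x0 n0 _ nd df L0 sf fge LA0 _ fi.
move=> p0 p1 eps0 gamma delta0.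
have omega0 : 0 <= omegaP R n by rewrite subr_ge0 ler1n.
have pV : 0 <= p^-1 - 1 by rewrite subr_ge0 invf_ge1.
pose B := LA * Num.sqrt (omegaP R n * (p^-1 - 1)).
have gammaE : gamma = (L + B)^-1 by [].
set M := L + LA * Num.sqrt (omegaP R n / p).
have B0 : 0 <= B by rewrite mulr_ge0// sqrtr_ge0.
(* The step size involves [p^-1 - 1], the iteration count the larger [p^-1]. *)
have BM : L + B <= M.
  by rewrite lerD2l ler_wpM2l// ler_wsqrtr// ler_wpM2l// lerBlDr lerDl ler01.
have LB0 : 0 < L + B by exact: ltr_wpDr.
have gamma0 : 0 < gamma by rewrite gammaE invr_gt0.
have delta0_ge0 : 0 <= delta0 by rewrite subr_ge0.
have B_sqr : B ^+ 2 = LA ^+ 2 * omegaP R n * (p^-1 - 1).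
  by rewrite exprMn sqr_sqrtr ?mulr_ge0// mulrA.
(* Since [gamma * (L + B) = 1], the left-hand side is [1 - b + b ^+ 2] with [b = gamma * B] between
   0 and 1. *)
have small : gamma * L + gamma ^+ 2 * LA ^+ 2 * omegaP R n * (p^-1 - 1) <= 1.
  have -> : gamma ^+ 2 * LA ^+ 2 * omegaP R n * (p^-1 - 1) = gamma ^+ 2 * B ^+ 2.
    by rewrite B_sqr; ring.
  have gLB : gamma * L = 1 - gamma * B by rewrite gammaE; field; rewrite gt_eqF.
  have gB1 : gamma * B <= 1.
    by have := mulr_ge0 (ltW gamma0) (ltW L0); rewrite gLB subr_ge0.
  have gB0 : 0 <= gamma * B by rewrite mulr_ge0// ltW.
  by rewrite gLB -exprMn; nra.
pose bound := 2 * (delta0 / eps * M).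
have bound0 : 0 <= bound.
  by rewrite mulr_ge0// mulr_ge0// ?divr_ge0 ?(ltW eps0)//; exact: le_trans (ltW LB0) BM.
(* Rounding down keeps [T] below [bound], while the number [T.+1] of averaged iterates exceeds
   it. *)
exists (Num.truncn bound); split; first by rewrite truncn_le.
move=> dO Omega P coin pi tau [coinP piP tauP indP] x.
pose G (st : 'rV[R]_d * ('I_n -> 'rV[R]_d)) := enorm (gradient (favg f) st.1) ^+ 2.
have -> : (fun w => x (tau w) w) = (fun w =>
    (chain (marinaP_step f gamma) (x0, fun=> x0) (coin^~ w) (pi^~ w) (tau w)).1).
  by apply/funext => w; rewrite /x marinaP_chain.
have p01 : 0 <= p <= 1 by rewrite ltW.
rewrite /stationary.
rewrite (expectation_chain (marinaP_step f gamma) (x0, fun=> x0) P p p01 _ _ _ tau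
  coinP piP tauP indP G) => [|st]; last exact: sqr_ge0.
rewrite lee_fin ler_pdivrMl ?ltr0n//.
apply: (le_trans (marinaP_rate f L LA LB p n0 nd df L0 sf fi p0 p1
  fstar gamma x0 _ gamma0 small fge)).
have : bound < (Num.truncn bound).+1%:R by exact: truncnS_gt.
rewrite gammaE invrK -/delta0 => /ltW /(ler_wpM2l (ltW eps0)).
rewrite [leRHS]mulrC; apply: le_trans.
have -> : eps * bound = delta0 * (2 * M) by rewrite /bound; field; rewrite gt_eqF.
by rewrite mulrC ler_wpM2l// ler_wpM2l.
Qed.
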